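(* Let $g$ and $\kappa$ be non-negative integers such that $2g \leq 3\kappa$ and let $\phi_3 := \phi|_{\mathcal{G}_\kappa(g,3)}$ be the restriction of $\phi$ to $\mathcal{G}_\kappa(g,3)$. Then $\operatorname{Im}(\phi_3) \subseteq \mathcal{G}_{\kappa+1}(g+1,3)$.
   Context: $\mathbb{N}$ denotes the positive integers. A gapset is a finite set $G \subset \mathbb{N}$ such that whenever $z \in G$ and $z = x+y$ with $x,y \in \mathbb{N}$, then $x \in G$ or $y \in G$. The genus of $G$ is its cardinality $g$; we write $G = \{\ell_1 < \ell_2 < \cdots < \ell_g\}$. The multiplicity is $m(G) := \min\{s \in \mathbb{N} : s \notin G\}$; the conductor $c(G)$ is the least $s$ such that $s+n \notin G$ for all integers $n \geq 0$ (so $c(G) = \ell_g+1$ for $G \ne \emptyset$, and $c(\emptyset)=0$); the depth is $q(G) := \lceil c(G)/m(G) \rceil$. For $g \geq 2$, $G$ is pure $\kappa$-sparse if $\ell_{i+1}-\ell_i \leq \kappa$ for all $i \in \{1,\dots,g-1\}$ and $\ell_{i+1}-\ell_i = \kappa$ for some $i$. By convention, $\emptyset$ is pure $0$-sparse and $\{1\}$ is pure $1$-sparse (and for no other value of the parameter). $\mathcal{G}_\kappa(g)$ denotes the set of all pure $\kappa$-sparse gapsets of genus $g$, and $\mathcal{G}_\kappa(g,q) := \{G \in \mathcal{G}_\kappa(g) : q(G) = q\}$. The map $\phi$: for $G = \{\ell_1 < \cdots < \ell_g\} \in \mathcal{G}_\kappa(g)$ with $g \geq 2$, let $\alpha :=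 \max\{i : \ell_{i+1}-\ell_i = \kappa\}$ and $$\phi(G) := \{1\} \cup \{\ell_i + 1 : 1 \leq i \leq \alpha\} \cup \{\ell_i + 2 : \alpha+1 \leq i \leq g\}.$$ By convention $\phi(\emptyset) = \{1\}$ and $\phi(\{1\}) = \{1,3\}$. *)

(* Defs.v *)
From mathcomp Require Import all_boot all_order all_algebra finmap.
From mathcomp Require Import boolp classical_sets.

Set Implicit Arguments.
Unset Strict Implicit.
Unset Printing Implicit Defensive.

Local Open Scope fset_scope.
Local Open Scope nat_scope.

(* Positive integers are represented in nat, hence the condition 0 \notin G
   and the explicit positivity of x and y. *)
Definition is_gapset (G : {fset nat}) : Prop :=
  0 \notin G /\
  forall x y z : nat, 0 < x -> 0 < y -> z \in G -> z = x + y ->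
    x \in G \/ y \in G.

Definition genus (G : {fset nat}) : nat := #|` G|.

(* Numbered from 1: G = {ell G 1 < ell G 2 < ... < ell G (genus G)}. *)
Definition ell (G : {fset nat}) (i : nat) : nat :=
  nth 0 (sort leq (enum_fset G)) i.-1.

Lemma fset_nat_bounded (G : {fset nat}) :
  exists s, (0 < s) && `[< forall n, s + n \notin G >].
Proof.
exists (\max_(x <- enum_fset G) x).+1; apply/asboolP => n.
apply/negP => sG; have := @leq_bigmax_seq _ (enum_fset G) xpredT id _ sG isT.
by rewrite addSn ltnNge leq_addr.
Qed.

Lemma multiplicity_ex (G : {fset nat}) : exists s, (0 < s) && (s \notin G).
Proof.
have [s /andP[s_gt0 /asboolP/(_ 0)]] := fset_nat_bounded G.
by rewrite addn0 => sG; exists s; rewrite s_gt0.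
Qed.

Lemma conductor_ex (G : {fset nat}) :
  exists s, `[< forall n, s + n \notin G >].
Proof. by have [s /andP[_ Hs]] := fset_nat_bounded G; exists s. Qed.

Definition multiplicity (G : {fset nat}) : nat := ex_minn (multiplicity_ex G).

(* The minimum is over s >= 0, so that the empty set has conductor 0. *)
Definition conductor (G : {fset nat}) : nat := ex_minn (conductor_ex G).

Definition depth (G : {fset nat}) : int :=
  Num.ceil ((conductor G)%:R / (multiplicity G)%:R : rat)%R.

(* Since ell G is increasing on 1..genus G, the truncated subtractions below
   are true differences. *)
Definition pure_sparse (k : nat) (G : {fset nat}) : Prop :=
  [\/ G = fset0 /\ k = 0,
      G = [fset 1] /\ k = 1
    | [/\ 2 <= genus G,
          forall i, 1 <= i <= genus G - 1 -> ell G i.+1 - ell G i <= k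
        & exists2 i, 1 <= i <= genus G - 1 & ell G i.+1 - ell G i = k]].

Definition pure_gapsets (k g : nat) : set {fset nat} :=
  [set G | [/\ is_gapset G, genus G = g & pure_sparse k G]]%classic.

Definition pure_gapsets_depth (k g q : nat) : set {fset nat} :=
  [set G | pure_gapsets k g G /\ depth G = (q%:Z)%R]%classic.

Definition alpha (k : nat) (G : {fset nat}) : nat :=
  \max_(1 <= i < genus G | ell G i.+1 - ell G i == k) i.

(* Meaningful for G in pure_gapsets k (genus G); the value of k is then
   determined by G. *)
Definition phi (k : nat) (G : {fset nat}) : {fset nat} :=
  if G == fset0 then [fset 1]
  else if G == [fset 1] then [fset 1; 3]
  else [fset 1]
       `|` [fset ell G i + 1 | i in index_iota 1 (alpha k G).+1]
       `|` [fset ell G i + 2 | i in index_iota (alpha k G).+1 (genus G).+1].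

(* Main.v *)
Require Import Defs.
From mathcomp Require Import all_boot all_order all_algebra finmap.
From mathcomp Require Import boolp classical_sets.
From mathcomp Require Import zify.
Import GRing.Theory Num.Theory.

(* Let m be the multiplicity of G and let a < b = a + k be the last two
   consecutive gaps at distance k.  Counting gaps among the pairs {i, b - i}
   gives b < 2g <= 3k, and b < 3m then forces a < 2m.
   Suppose z = x + y with z in phi(G) and x, y outside.  Then x, y >= m + 1, so
   z >= 2m + 2 cannot be l + 1 with l <= a, and z = l + 2 with l > a a gap.
   If b >= 2m then x, y <= 2m <= b since l < 3m.  If b < 2m then no gap exceeds
   a + m, because a + m + 1, ..., b + m - 1 are nongaps and a gap beyond them
   would create a later jump of length at least k; so x, y <= a + 1 <= b.
   In both cases x - 1 and y - 1 are nongaps of G with sum the gap l, which is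
   absurd. *)

(** * Increasing enumeration of a finite set *)

Lemma genusE (G : {fset nat}) : genus G = size (sort leq (enum_fset G)).
Proof. by rewrite size_sort. Qed.

Lemma sorted_sort_fset (G : {fset nat}) : sorted ltn (sort leq (enum_fset G)).
Proof.
by rewrite ltn_sorted_uniq_leq sort_uniq fset_uniq (sort_sorted leq_total).
Qed.

Lemma ell_mem (G : {fset nat}) i : 0 < i <= genus G -> ell G i \in G.
Proof.
case: i => [|i]; rewrite ?ltnn //= genusE => lti.
by have := mem_nth 0 lti; rewrite mem_sort.
Qed.

Lemma ellP (G : {fset nat}) x :
  x \in G -> exists2 i, 0 < i <= genus G & ell G i = x.
Proof.
rewrite -[x \in G](mem_sort leq) => xG.
exists (index x (sort leq (enum_fset G))).+1; last by rewrite /ell nth_index.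
by rewrite genusE /= index_mem.
Qed.

Lemma ell_lt (G : {fset nat}) i j :
  0 < i -> i < j <= genus G -> ell G i < ell G j.
Proof.
case: i j => [|i] [|j] // _; rewrite genusE ltnS => /andP[ij jg].
apply: (sorted_ltn_nth ltn_trans 0 (sorted_sort_fset G)) => //.
by rewrite inE; apply: leq_ltn_trans jg; apply: ltnW.
Qed.

Lemma ell_ltE (G : {fset nat}) i j : 0 < i <= genus G -> 0 < j <= genus G ->
  (ell G i < ell G j) = (i < j).
Proof.
move=> /andP[i0 ig] /andP[j0 jg]; have [ij|ji|->] := ltngtP i j.
- by apply: ell_lt; rewrite ?ij.
- by apply/negbTE; rewrite -leqNgt ltnW // ell_lt // ji.
- by rewrite ltnn.
Qed.

Lemma ell_leE (G : {fset nat}) i j : 0 < i <= genus G -> 0 < j <= genus G ->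
  (ell G i <= ell G j) = (i <= j).
Proof. by move=> hi hj; rewrite leqNgt ell_ltE // -leqNgt. Qed.

Lemma ell_between (G : {fset nat}) i x :
  0 < i < genus G -> ell G i < x < ell G i.+1 -> x \notin G.
Proof.
move=> /andP[i0 ig] /andP[xl xr]; apply/negP => /ellP[j jg xE].
have ig' : 0 < i <= genus G by rewrite i0 ltnW.
by move: xl xr; rewrite -xE !ell_ltE // ltnS => ij; rewrite leqNgt ij.
Qed.

(** * Multiplicity, conductor and depth; a bound on gaps by the genus *)

Lemma multiplicityP (G : {fset nat}) :
  [/\ 0 < multiplicity G, multiplicity G \notin G
    & forall i, 0 < i < multiplicity G -> i \in G].
Proof.
rewrite /multiplicity; case: ex_minnP => m /andP[m0 mG] m_min; split=> // i.
by case/andP=> i0; rewrite ltnNge; apply: contraR => iG; apply: m_min; rewrite i0.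
Qed.

Lemma multiplicity_eq (G : {fset nat}) m :
  0 < m -> m \notin G -> (forall i, 0 < i < m -> i \in G) -> multiplicity G = m.
Proof.
move=> m0 mG mlt; have [n0 nG nlt] := multiplicityP G.
case: (ltngtP (multiplicity G) m) => // [h|h].
- by rewrite mlt ?n0 in nG.
- by rewrite nlt ?m0 in mG.
Qed.

Lemma conductor_eq (G : {fset nat}) l :
  l \in G -> (forall x, x \in G -> x <= l) -> conductor G = l.+1.
Proof.
move=> lG l_max; rewrite /conductor; case: ex_minnP => c /asboolP cG c_min.
apply/eqP; rewrite eqn_leq c_min /=; last first.
  by apply/asboolP => n; apply/negP => /l_max; rewrite addSn ltnNge leq_addr.
by rewrite ltnNge; apply/negP => /subnKC cl; move: (cG (l - c)); rewrite cl lG.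
Qed.

Lemma conductor_ell (G : {fset nat}) :
  0 < genus G -> conductor G = (ell G (genus G)).+1.
Proof.
move=> g0; apply: conductor_eq; first by rewrite ell_mem // g0 /=.
by move=> x /ellP[i ig <-]; rewrite ell_leE ?g0 ?leqnn //; case/andP: ig.
Qed.

(** The ceiling of [c / m] is [q.+1] exactly when [q < c / m <= q.+1]; since [m > 0], denominators
    can be cleared. Using [q.+1] keeps the lower bound in [nat]. *)
Lemma depthP (G : {fset nat}) q : depth G = (q.+1%:Z)%R <->
  q * multiplicity G < conductor G <= q.+1 * multiplicity G.
Proof.
have [m0 _ _] := multiplicityP G.
have -> : (depth G = q.+1%:Z%R) <-> (depth G == q.+1%:Z%R) by split=> /eqP.
have m0R : (0 < (multiplicity G)%:R :> rat)%R by rewrite ltr0n.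
rewrite /depth ceil_eq ltr_pdivlMr // ler_pdivrMr //.
have -> : (q.+1%:Z - 1 = q%:Z)%R by lia.
by rewrite -!pmulrn -!natrM ltr_nat ler_nat.
Qed.

(* Of the two entries of each pair (i, b - i) with 0 <= i <= b at least one is
   a gap, the pair (0, b) included. *)
Lemma gap_lt_double_genus (G : {fset nat}) b :
  is_gapset G -> b \in G -> b < 2 * genus G.
Proof.
move=> [_ gapG] bG; rewrite -[b.+1](size_iota 0) mul2n -addnn.
have -> : genus G + genus G =
    size (enum_fset G ++ [seq b - x | x <- enum_fset G]).
  by rewrite size_cat size_map.
apply: uniq_leq_size; first exact: iota_uniq.
move=> i; rewrite mem_iota add0n ltnS mem_cat => /andP[_ ib].
have [i0|i0] := posnP i.
  by apply/orP; right; apply/mapP; exists b; rewrite // i0 subnn.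
have [->|iNb] := eqVneq i b; first by rewrite bG.
have bi0 : 0 < b - i by rewrite subn_gt0 ltn_neqAle iNb.
have [->//|biG] := gapG _ _ _ i0 bi0 bG (esym (subnKC ib)).
by apply/orP; right; apply/mapP; exists (b - i); rewrite ?subKn.
Qed.

(** * The last jump of length [k] *)

Lemma bigmax_nat_mem (P : pred nat) m n i : m <= i < n -> P i ->
  let M := \max_(m <= j < n | P j) j in [/\ m <= M < n, P M & i <= M].
Proof.
move=> imn Pi M; have iM : i <= M.
  by apply: (@leq_bigmax_seq _ _ P id); rewrite ?mem_index_iota.
(* The invariant admits 0, the value of an empty maximum; if [M = 0], then [i <= M] forces [i = M],
   so the maximum is attained anyway. *)
suff [M0|[]] : M = 0 \/ (m <= M < n /\ P M).
  have i0 : i = M by apply/eqP; move: iM; rewrite M0 leqn0.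
  by rewrite -i0 leqnn.
  by [].
rewrite /M big_seq_cond; apply: (big_ind (fun x => x = 0 \/ (m <= x < n /\ P x))).
- by left.
- by move=> x y Hx Hy; case: (leqP x y) => h; rewrite ?(maxn_idPr h) ?(maxn_idPl (ltnW h)).
- by move=> j; rewrite mem_index_iota => /andP[]; right.
Qed.

(** Purity supplies a jump of length exactly [k], so the maximum defining [alpha k G] is attained;
    its maximality makes all later jumps shorter than [k]. *)
Lemma pure_sparse_alpha k (G : {fset nat}) : 2 <= genus G -> pure_sparse k G ->
  [/\ 0 < alpha k G < genus G,
      ell G (alpha k G).+1 = ell G (alpha k G) + k,
      forall i, 0 < i < genus G -> ell G i.+1 <= ell G i + k
    & forall i, alpha k G < i < genus G -> ell G i.+1 < ell G i + k].
Proof.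
move=> g2 [[G0 _]|[G1 _]|[_ le_k [i ig ik]]].
- by rewrite G0 /genus cardfs0 in g2.
- by rewrite G1 /genus cardfs1 in g2.
have incr j : 0 < j < genus G -> ell G j < ell G j.+1.
  by move=> /andP[j0 jg]; apply: ell_lt; rewrite ?ltnSn.
have ig' : 1 <= i < genus G by lia.
have [aitv /eqP ak _] : [/\ 0 < alpha k G < genus G,
    ell G (alpha k G).+1 - ell G (alpha k G) == k & i <= alpha k G].
  exact: bigmax_nat_mem (fun j => ell G j.+1 - ell G j == k) _ _ _ ig' (introT eqP ik).
have le_k' j : 0 < j < genus G -> ell G j.+1 <= ell G j + k.
  by move=> jg; have := incr j jg; have := le_k j; lia.
split=> // [|j /andP[aj jg]]; first by have := incr _ aitv; lia.
have j0 : 0 < j < genus G by lia.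
rewrite ltn_neqAle le_k' // andbT; apply/eqP => jk.
have jP : ell G j.+1 - ell G j == k by rewrite jk addKn.
by have [_ _] := bigmax_nat_mem (fun j => ell G j.+1 - ell G j == k) _ _ _ j0 jP; rewrite -/(alpha k G) leqNgt aj.
Qed.

(** * Enumeration of [phi k G] *)

(** The elements of [phi k G] in increasing order, from which its genus and its [ell] are read off
    by position. *)
Definition shifted_gaps k (G : {fset nat}) : seq nat :=
  1 :: [seq ell G i + (if i <= alpha k G then 1 else 2) | i <- iota 1 (genus G)].

(** The shift only grows along the list, so order is preserved; as gaps are positive, the shifted
    ones all exceed the leading 1. *)
Lemma sorted_shifted_gaps k (G : {fset nat}) :
  0 \notin G -> sorted ltn (shifted_gaps k G).
Proof.
move=> G0; apply/(sortedP 0) => -[|i]; rewrite /= size_map size_iota ltnS => ig.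
  rewrite (nth_map 0) ?size_iota // nth_iota //.
  have : ell G 1 \in G by rewrite ell_mem.
  by case: (ell G 1) => [|n]; [rewrite (negbTE G0) | case: ifP => _; rewrite ?addnS].
rewrite !(nth_map 0) ?size_iota ?nth_iota //; try lia.
have : ell G i.+1 < ell G i.+2 by apply: ell_lt => //; lia.
by rewrite !add1n; do 2 case: ifP; lia.
Qed.

Lemma phi_shifted_gaps k (G : {fset nat}) : 2 <= genus G -> alpha k G < genus G ->
  phi k G =i shifted_gaps k G.
Proof.
move=> g2 ag x; rewrite /phi.
case: eqP => [G0|_]; first by rewrite G0 /genus cardfs0 in g2.
case: eqP => [G1|_]; first by rewrite G1 /genus cardfs1 in g2.
rewrite !in_fsetE inE -orbA; congr orb.
apply/idP/idP => [/orP[]/imfsetP[i /=]|/mapP[i]].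
- rewrite mem_index_iota => /andP[i0 ia] ->; apply/mapP; exists i.
    by rewrite mem_iota; lia.
  by rewrite -ltnS ia.
- rewrite mem_index_iota => /andP[ia ig] ->; apply/mapP; exists i.
    by rewrite mem_iota; lia.
  by rewrite leqNgt ia.
rewrite mem_iota => ig ->; apply/orP; case: leqP => ia; [left|right];
  apply/imfsetP; exists i => //=; rewrite mem_index_iota; lia.
Qed.

Lemma sort_phi k (G : {fset nat}) :
  0 \notin G -> 2 <= genus G -> alpha k G < genus G ->
  sort leq (enum_fset (phi k G)) = shifted_gaps k G.
Proof.
move=> G0 g2 ag; apply: (irr_sorted_eq ltn_trans ltnn) => [||x].
- exact: sorted_sort_fset.
- exact: sorted_shifted_gaps.
- by rewrite mem_sort -phi_shifted_gaps.
Qed.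

Lemma genus_phi k (G : {fset nat}) :
  0 \notin G -> 2 <= genus G -> alpha k G < genus G ->
  genus (phi k G) = (genus G).+1.
Proof. by move=> *; rewrite genusE sort_phi //= size_map size_iota. Qed.

Lemma ell_phi1 k (G : {fset nat}) :
  0 \notin G -> 2 <= genus G -> alpha k G < genus G -> ell (phi k G) 1 = 1.
Proof. by move=> *; rewrite /ell sort_phi. Qed.

Lemma ell_phiS k (G : {fset nat}) i :
  0 \notin G -> 2 <= genus G -> alpha k G < genus G -> 0 < i <= genus G ->
  ell (phi k G) i.+1 = ell G i + (if i <= alpha k G then 1 else 2).
Proof.
move=> G0 g2 ag; case: i => [|i] //= ig; rewrite {1}/ell sort_phi //=.
by rewrite (nth_map 0) ?size_iota // nth_iota.
Qed.

Lemma mem_phi k (G : {fset nat}) x :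
  2 <= genus G -> 0 < alpha k G < genus G ->
  x \in phi k G <-> [\/ x = 1,
    exists2 u, u \in G & u <= ell G (alpha k G) /\ x = u + 1
  | exists2 u, u \in G & ell G (alpha k G) < u /\ x = u + 2].
Proof.
move=> g2 ag; have [a0 ag1] := andP ag.
have ag' : 0 < alpha k G <= genus G by lia.
rewrite phi_shifted_gaps // inE; split=> [/orP[/eqP->|/mapP[i]]|].
- by constructor 1.
- rewrite mem_iota => ig ->; have ig' : 0 < i <= genus G by lia.
  case: leqP => ia; [constructor 2|constructor 3]; exists (ell G i);
    by rewrite ?ell_mem ?ell_leE ?ell_ltE.
case=> [->|[u /ellP[i ig <-]]|[u /ellP[i ig <-]]]; first by rewrite eqxx.
- rewrite ell_leE // => -[ia ->]; apply/orP; right; apply/mapP.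
  by exists i; rewrite ?mem_iota ?ia //; lia.
- rewrite ell_ltE // => -[ia ->]; apply/orP; right; apply/mapP.
  by exists i; rewrite ?mem_iota 1?leqNgt ?ia //; lia.
Qed.

(** * The image is a gapset *)

Lemma gapset_phi k (G : {fset nat}) :
  2 <= genus G -> 2 * genus G <= 3 * k -> is_gapset G -> pure_sparse k G ->
  conductor G <= 3 * multiplicity G -> is_gapset (phi k G).
Proof.
move=> g2 hgk GG spG; rewrite conductor_ell; last by lia.
have [G0 gapG] := GG; have [m0 mG ltm] := multiplicityP G.
have [aitv bE _ ltk] := pure_sparse_alpha _ _ g2 spG.
have memphi x := mem_phi k G x g2 aitv.
have bG : ell G (alpha k G).+1 \in G by apply: ell_mem; lia.
have between := ell_between _ _ _ aitv.
have [b bdef] : {b | b = ell G (alpha k G).+1} by eexists.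
rewrite -bdef in bG bE between.
move: (multiplicity G) (ell G (alpha k G)) m0 mG ltm memphi between bE.
move=> m a m0 mG ltm memphi between bE max_lt.
have max_gap u : u \in G -> u < 3 * m.
  move=> /ellP[i ig <-]; apply: leq_trans max_lt.
  by rewrite ltnS ell_leE //; lia.
(* From [2 <= genus G] and [2 * genus G <= 3 * k] one gets [k >= 2], so [a + 1] lies strictly
   between [a] and [b] and is a nongap. *)
have ma : m <= a.+1.
  rewrite leqNgt; apply/negP => am.
  by have := ltm a.+1 am; apply/negP/between; lia.
(* b < 2g <= 3 (b - a), so a >= 2m would force b > 3m. *)
have a_lt : a < 2 * m.
  have := gap_lt_double_genus _ _ GG bG; have := max_gap _ bG; lia.
(* Otherwise the first gap v beyond a + m satisfies v < b + m by maximality of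
   alpha, so that v - m lies strictly between a and b. *)
have le_am u : u \in G -> b < 2 * m -> u <= a + m.
  move=> uG bm; rewrite leqNgt; apply/negP => amu.
  have exj : exists j, (0 < j <= genus G) && (a + m < ell G j).
    by have [j jg uE] := ellP _ _ uG; exists j; rewrite jg uE.
  have [j /andP[jg amj] j_min] := ex_minnP exj.
  (* Since [b < 2 * m] and [m <= a + 1], one has [b <= a + m]: a gap beyond [a + m] comes after
     [b]. *)
  have aj : (alpha k G).+1 < j by rewrite -(ell_ltE G) -?bdef; lia.
  have jam : ell G j.-1 <= a + m.
    by rewrite leqNgt; apply/negP => h; have := j_min j.-1; rewrite h; lia.
  have := ltk j.-1; rewrite prednK; last by lia.
  move=> /(_ ltac:(lia)) jk.
  have mj : 0 < ell G j - m by lia.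
  have [|/negP[]|] := gapG _ _ _ m0 mj (ell_mem _ _ jg).
  - by lia.
  - by rewrite (negbTE mG).
  - by apply/negP/between; lia.
(* A gap below [b] is at most [a], hence is shifted by one only: if [x - 1] were a gap, [x] would
   lie in [phi k G]. *)
have phiS x : 0 < x -> x \notin phi k G -> x <= b -> 0 < x.-1 /\ x.-1 \notin G.
  move=> x0 xphi xb; have x1 : x != 1.
    by apply: contra xphi => /eqP x1; apply/memphi; constructor 1.
  split; first by lia.
  apply: contra xphi => xG; apply/memphi; constructor 2; exists x.-1 => //.
  split; last by lia.
  by rewrite leqNgt; apply: contraL xG => ax; apply: between; lia.
have phi_gt x : 0 < x -> x \notin phi k G -> m < x.
  move=> x0 xphi; rewrite ltnNge; apply/negP => xm.
  by have [|x1 /negP[]] := phiS _ x0 xphi; [|apply: ltm]; lia.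
split=> [|x y z x0 y0 zphi zE].
  by apply/negP => /memphi[//|[u _ [_]]|[u _ [_]]]; lia.
have [xphi|xphi] := boolP (x \in phi k G); first by left.
have [yphi|yphi] := boolP (y \in phi k G); first by right.
have xm := phi_gt _ x0 xphi; have ym := phi_gt _ y0 yphi.
have /memphi[z1|[u uG [ua zu]]|[u uG [au zu]]] := zphi; try by lia.
(* As [x] and [y] exceed [m] and sum to [u + 2], each is at most [u + 1 - m]. This is at most [b] by
   [um] if [2 * m <= b], and by [u_am] otherwise. *)
have := max_gap _ uG; have := le_am _ uG => u_am um.
have [|x1 xG] := phiS _ x0 xphi; first by lia.
have [|y1 yG] := phiS _ y0 yphi; first by lia.
have [|h|h] := gapG _ _ _ x1 y1 uG; first by lia.
- by rewrite h in xG.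
- by rewrite h in yG.
Qed.

(** * Multiplicity, conductor and sparsity of the image *)

(** With [a] the gap before the last jump [k], [k >= 2] gives [m <= a + 1]. So the gaps
    [1, ..., m - 1] all move up by one, below them 1 is added, and [m + 1] is not reached by a shift
    of two, which would need [m - 1 > a]. *)
Lemma multiplicity_phi k (G : {fset nat}) :
  2 <= genus G -> 2 <= k -> is_gapset G -> pure_sparse k G ->
  multiplicity (phi k G) = (multiplicity G).+1.
Proof.
move=> g2 k2 [G0 _] spG; have [m0 mG ltm] := multiplicityP G.
have [aitv bE _ _] := pure_sparse_alpha _ _ g2 spG.
have ma : multiplicity G <= (ell G (alpha k G)).+1.
  rewrite leqNgt; apply/negP => am.
  by have := ltm (ell G (alpha k G)).+1 am; apply/negP/(ell_between _ _ _ aitv); lia.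
have memphi x := mem_phi k G x g2 aitv.
apply: multiplicity_eq => // [|i im].
- apply/negP => /memphi[|[u uG [_ uE]]|[u uG [au uE]]]; try by lia.
  by move/negP: mG; apply; have -> : multiplicity G = u by lia.
- apply/memphi; have [->|i1] := eqVneq i 1; first by constructor 1.
  constructor 2; exists i.-1; last by lia.
  by apply: ltm; lia.
Qed.

(** The last gap has index beyond [alpha k G], so it moves by two. *)
Lemma conductor_phi k (G : {fset nat}) :
  0 \notin G -> 2 <= genus G -> alpha k G < genus G ->
  conductor (phi k G) = conductor G + 2.
Proof.
move=> G0 g2 ag; rewrite !conductor_ell ?genus_phi //; last by lia.
by rewrite ell_phiS; [case: ifP; lia | | | | lia].
Qed.

(** A least gap [l >= 2] would split as [1 + (l - 1)], making one of these smaller numbers a gap. *)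
Lemma gapset_ell1 (G : {fset nat}) : is_gapset G -> 0 < genus G -> ell G 1 = 1.
Proof.
move=> [G0 gapG] g0; have l1G : ell G 1 \in G by rewrite ell_mem.
have l1_min x : x \in G -> ell G 1 <= x.
  by move=> /ellP[i ig <-]; rewrite ell_leE //; lia.
have l1 : 0 < ell G 1 by rewrite lt0n; apply: contraNneq G0 => <-.
apply/eqP; rewrite eqn_leq l1 andbT leqNgt; apply/negP => l2.
have l1' : 0 < (ell G 1).-1 by lia.
by have [|/l1_min|/l1_min] := gapG _ _ _ (ltn0Sn 0) l1' l1G; lia.
Qed.

(** The new first jump, from 1 to 2, has length 1. The other jumps are those of [G], except that the
    one at [alpha k G] grows from [k] to [k.+1], because the shift changes there. *)
Lemma pure_sparse_phi k (G : {fset nat}) :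
  is_gapset G -> 2 <= genus G -> pure_sparse k G -> pure_sparse k.+1 (phi k G).
Proof.
move=> GG g2 spG; have [aitv bE le_k _] := pure_sparse_alpha _ _ g2 spG.
have [G0 _] := GG; have [a0 ag] := andP aitv.
constructor 3; rewrite genus_phi // subn1 /=; split; first by lia.
- case=> [|[|i]] // ig.
    by rewrite ell_phi1 // ell_phiS ?gapset_ell1 ?a0 //; lia.
  rewrite !ell_phiS //; try lia.
  by have := le_k i.+1; do 2 case: ifP; lia.
- exists (alpha k G).+1; first by lia.
  rewrite !ell_phiS //; try lia.
  by rewrite bE; do 2 case: ifP; lia.
Qed.

Theorem theorem4p8 (g k : nat) (hgk : 2 * g <= 3 * k) :
  (phi k @` pure_gapsets_depth k g 3 `<=` pure_gapsets_depth k.+1 g.+1 3)%classic.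
Proof.
move=> _ [G [[GG gE spG] dG] <-]; have [G0 _] := GG.
have /andP[c_gt c_le] := (depthP G 2).1 dG.
have [m0 _ _] := multiplicityP G.
(* Depth 3 means [2 * m < c] for the conductor [c], with [m >= 1]. This excludes the empty set,
   where [c = 0], and then genus 1, where the only gap is 1 and [c = 2]. *)
have g0 : 0 < genus G.
  rewrite lt0n; apply/eqP => g0.
  have : conductor G <= 0.
    rewrite /conductor; case: ex_minnP => c _; apply; apply/asboolP => n.
    by move/eqP: g0; rewrite cardfs_eq0 => /eqP->.
  by lia.
have cE := conductor_ell _ g0.
have g2 : 2 <= genus G.
  rewrite ltn_neqAle g0 andbT; apply/eqP => g1.
  have l1 := gapset_ell1 _ GG g0; rewrite -g1 l1 in cE.
  by lia.
have [/andP[_ ag] _ _ _] := pure_sparse_alpha _ _ g2 spG.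
rewrite -gE in hgk *; split; first split.
- exact: gapset_phi.
- exact: genus_phi.
- exact: pure_sparse_phi.
(* From [2 * m < c <= 3 * m] follows [2 * (m + 1) < c + 2 <= 3 * (m + 1)]. *)
- apply/(depthP _ 2); rewrite multiplicity_phi ?conductor_phi //; lia.
Qed.
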